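(* Let $(V,\|\cdot\|)$ be a finite-dimensional real normed space with $\dim V\ge 1$, and let $X\subseteq V$ be a non-empty subset with the induced metric. Then $$d_{\mathrm{GH}}(V,X)\ \ge\ \frac{1}{2\,J_s(V)}\,d_{\mathrm{H}}(V,X),$$ as an inequality in $[0,\infty]$, where $J_s(V)$ is the relative Jung constant of $V$.
   Context: For non-empty subsets $A,A'$ of a metric space $Z$ with distance $|xy|$ between points $x,y$, write $|xA|=\inf_{a\in A}|xa|$. The Hausdorff distance is $d_{\mathrm{H}}(A,A')=\max\{\sup_{a\in A}|aA'|,\ \sup_{a'\in A'}|a'A|\}\in[0,\infty]$. For non-empty metric spaces $X,Y$, the Gromov--Hausdorff distance $d_{\mathrm{GH}}(X,Y)\in[0,\infty]$ is the infimum of $d_{\mathrm{H}}(X',Y')$ over all metric spaces $Z$ and all subsets $X',Y'\subseteq Z$ isometric to $X$ and $Y$ respectively. Equivalently, $d_{\mathrm{GH}}(X,Y)=\frac12\inf_R\operatorname{dis}R$, where $R$ ranges over all correspondences (subsets $R\subseteq X\times Y$ projecting onto both $X$ and $Y$) and $\operatorname{dis}R=\sup\{||xx'|-|yy'||:(x,y),(x',y')\in R\}$. Relative Jung constant: for a non-empty bounded subset $X$ and a non-empty subset $Y$ of a metric space, the relative Chebyshev radius is $R_Y(X)=\inf_{y\in Y}\sup_{x\in X}|xy|$. For a normed space $V$ containing at least two points, $$J_s(V)=\sup\{R_{\operatorname{conv}X}(X): X\subseteq V,\ \operatorname{diam}X=1\},$$ where $\operatorname{conv}X$ is the convex hull of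 $X$. *)

(* Defs.v *)
From HB Require Import structures.
From mathcomp Require Import all_boot all_order all_algebra.
From mathcomp Require Import all_classical all_reals all_analysis.

Set Implicit Arguments.
Unset Strict Implicit.
Unset Printing Implicit Defensive.

Import Order.TTheory GRing.Theory Num.Theory.
Import numFieldNormedType.Exports.

Local Open Scope classical_set_scope.
Local Open Scope ring_scope.
Local Open Scope ereal_scope.

(* Finite-dimensional normed spaces; the dimension of V is \dim {:V}. *)
#[short(type="normedVectType")]
HB.structure Definition NormedVector (R : numFieldType) :=
  {V of NormedModule R V & Vector R V}.

Section metric_of_normed.
Context {R : realFieldType}.

(* MathComp-Analysis does not make a normed space a metricType, hence this
   alias (in the style of convex_lmodType) with distance |xy| = `|x - y|. *)
Definition metric_normed (V : normedModType R) : Type := V.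

Variable V : normedModType R.

Let dist (x y : V) : R := `|x - y|%R.

Let dist_ge0 x y : (0 <= dist x y)%R. Proof. exact: normr_ge0. Qed.

Let dist_positivity x y : dist x y = 0%R -> x = y.
Proof. by move/normr0_eq0/eqP; rewrite subr_eq0 => /eqP. Qed.

Let ballEdist x d : ball x d = [set y | (dist x y < d)%R].
Proof. by rewrite -ball_normE. Qed.

HB.instance Definition _ := PseudoMetric.on (metric_normed V).
HB.instance Definition _ := @PseudoMetric_isMetric.Build R (metric_normed V)
  dist dist_ge0 dist_positivity ballEdist.

End metric_of_normed.

Section metric_notions.
Context {R : realType}.

(* All suprema and infima are taken in \bar R, so that the empty supremum is
   -oo and the empty infimum is +oo; the sets below are meant non-empty. *)

Definition dist_to_set (Z : metricType R) (x : Z) (A : set Z) : \bar R :=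
  ereal_inf [set (mdist x a)%:E | a in A].

Definition hausdorff_dist (Z : metricType R) (A A' : set Z) : \bar R :=
  maxe (ereal_sup [set dist_to_set a A' | a in A])
       (ereal_sup [set dist_to_set a' A | a' in A']).

(* A and B, with their induced metrics, are isometric.  Only the values of f
   on A matter. *)
Definition isometric (S T : metricType R) (A : set S) (B : set T) : Prop :=
  exists f : S -> T,
    (forall x y, A x -> A y -> mdist (f x) (f y) = mdist x y) /\ f @` A = B.

(* Metric spaces are given as subsets, with the induced metric, of ambient
   metric spaces; a space T itself is [set: T]. *)
Definition gromov_hausdorff_dist (S T : metricType R)
    (A : set S) (B : set T) : \bar R :=
  ereal_inf [set r | exists (Z : metricType R) (A' B' : set Z),
    [/\ isometric A A', isometric B B' & r = hausdorff_dist A' B']].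

Definition diameter (Z : metricType R) (A : set Z) : \bar R :=
  ereal_sup [set (mdist x y)%:E | x in A & y in A].

Definition relative_chebyshev_radius (Z : metricType R) (Y X : set Z) : \bar R :=
  ereal_inf [set ereal_sup [set (mdist x y)%:E | x in X] | y in Y].

Definition convex_hull (V : lmodType R) (X : set V) : set V :=
  smallest (@convex_set R V) X.

(* The condition diameter X = 1 excludes the empty set, of diameter -oo. *)
Definition relative_jung_constant (V : normedModType R) : \bar R :=
  ereal_sup [set relative_chebyshev_radius (convex_hull X : set (metric_normed V)) X
            | X in [set X : set (metric_normed V) | diameter X = 1]].

End metric_notions.

(* Main.v *)
Require Import Defs.
From HB Require Import structures.
From mathcomp Require Import all_boot all_order all_algebra all_fingroup finmap.
From mathcomp Require Import all_classical all_reals all_analysis.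
From mathcomp Require Import zify lra.

(** The Hausdorff distance between copies of V and X in a common metric space
    being less than r, every point of V has a point of X at distance less than
    r in that space.  Choosing one gives f : V -> X changing distances by at
    most d = 2r.  Such an f need not be continuous and its image may be
    discrete; the point of the proof is that f(V) is nevertheless within J d
    of every point p of V, J being the relative Jung constant, whence
    d_H(V, X) <= 2 J r and the theorem.

    For given p, a map F : V -> V is built that is continuous on a large ball
    around the origin and stays there within J d (plus an error as small as
    desired) of f(V), and F is shown to take the value p.

    - Construction of F ([continuous_approximation]).  Send every small finite
      set s of a fine net to a Chebyshev centre y_s of f(s): as f(s) has
      diameter at most about d, all the points of f(s) are within about J d of
      y_s.  At x, average the y_s over the superlevel sets s of the tent
      functions centred on the net.  These superlevel sets form a chain, so
      they share a net point v, the one where the tent is highest; all the y_s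
      that occur lie in a ball of radius J d around f(v), and so does their
      average.  This plays the role of the map that is affine on a barycentric
      subdivision and sends barycentres to Chebyshev centres.  Averaging the
      values of f themselves would only give the bound d: the centres are what
      brings in the factor J.

    - F takes the value p ([near_isometry_approx_surj]).  A limit of the rescaled maps
      f(n x)/n along an ultrafilter is an isometry U of V, which is onto
      because isometric self-embeddings of compact balls are.  On a ball of
      large radius N the map F is within a small multiple of N of the
      rescaling of U ([near_isometry_rescaled]), so composing F with the
      inverse of that rescaling gives a continuous map within N/4 of the
      identity on the ball of radius N/2, even after subtracting the image
      of p; such a map has a zero ([zero_near_identity]).

    - The last step is Brouwer's theorem in the form: a continuous self-map of
      V that is the identity outside a ball has a zero ([rV_zero]).  It follows
      by compactness from a Sperner lemma for cubical grids ([kuhn_cube]),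
      obtained from the fact that on the Kuhn triangulation of a torus every
      labelling has an even number of panchromatic simplices. *)

Set Implicit Arguments.
Unset Strict Implicit.
Unset Printing Implicit Defensive.

Import Order.TTheory GRing.Theory Num.Theory.
Import numFieldNormedType.Exports.
Import VectorInternalTheory.

(** * Panchromatic simplices on the torus *)

Lemma xor_pred1 (T : finType) (P : pred T) (x : T) :
  (forall y, P y = (y == x)) -> \big[addb/false]_y P y = true.
Proof.
move=> Px; rewrite (bigD1 x) //= Px eqxx big1 ?addbF // => y.
by rewrite Px => /negPf.
Qed.

Lemma xor_pred2 (T : finType) (P : pred T) (x1 x2 : T) : x1 != x2 ->
  (forall y, P y = (y == x1) || (y == x2)) -> \big[addb/false]_y P y = false.
Proof.
move=> x12 Px; rewrite (bigD1 x1) //= (bigD1 x2) 1?eq_sym //= !Px !eqxx orbT /=.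
by rewrite big1 // => y /andP[/negPf yx1 /negPf yx2]; rewrite Px yx1 yx2.
Qed.

Section one_simplex.
Variables (n : nat) (c : 'I_n.+1 -> 'I_n.+1).

Definition panchromatic := [forall b, exists k, c k == b].

(** The facet opposite to vertex [k] carries all the labels but the last. *)
Definition door (k : 'I_n.+1) :=
  [forall b, (b != ord_max) ==> [exists j, (j != k) && (c j == b)]].

Lemma panchromatic_inj : panchromatic -> injective c.
Proof.
move=> /forallP pan; apply/injectiveP/card_uniqP; rewrite size_map size_enum_ord.
rewrite -[RHS](card_ord n.+1); apply: eq_card => b; rewrite inE.
by have /existsP[k /eqP <-] := pan b; rewrite codom_f.
Qed.

(** The [n] vertices other than [k] are mapped onto the [n] labels other than
    the last one, hence bijectively. *)
Lemma door_inj k : door k ->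
  {in [pred j | j != k] &, injective c} /\ (forall j, j != k -> c j != ord_max).
Proof.
move=> /forallP dk.
have img : [set c j | j in [set~ k]] = [set~ ord_max].
  apply/esym/eqP; rewrite eqEcard; apply/andP; split.
    apply/fintype.subsetP => b; rewrite !inE => bm.
    have /implyP/(_ bm)/existsP[j /andP[jk /eqP <-]] := dk b.
    by apply: imset_f; rewrite !inE.
  by rewrite (leq_trans (leq_imset_card _ _)) // !cardsC1.
split.
  have /imset_injP : #|[set c j | j in [set~ k]]| == #|[set~ k]|.
    by rewrite img !cardsC1.
  by move=> inj x y xk yk; apply: inj; rewrite !inE.
move=> j jk; have : c j \in [set~ ord_max] by rewrite -img imset_f // !inE.
by rewrite !inE.
Qed.

(** The counting step of Sperner's lemma: a panchromatic simplex has one door,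
    opposite to its vertex with the last label; otherwise, if there is a door,
    exactly two vertices share a label and the doors are opposite to them. *)
Lemma xor_door : \big[addb/false]_k door k = panchromatic.
Proof.
case: (boolP panchromatic) => [pan|npan].
  have inj := panchromatic_inj pan.
  have /existsP[k0 /eqP ck0] := forallP pan ord_max.
  apply: (@xor_pred1 _ _ k0) => k; apply/idP/eqP => [dk|->].
    apply/eqP; apply: contraT => kk0.
    by have [_ /(_ k0)] := door_inj dk; rewrite eq_sym ck0 eqxx => /(_ kk0).
  apply/forallP => b; apply/implyP => bm.
  have /existsP[j /eqP cj] := forallP pan b; apply/existsP; exists j.
  rewrite cj eqxx andbT; apply: contraNneq bm => jk; apply/eqP.
  by rewrite -cj jk.
case: (boolP [exists k, door k]) => [/existsP[k1 d1]|]; last first.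
  rewrite negb_exists => /forallP nd; rewrite big1 // => k _.
  exact: negbTE.
have ck1 : c k1 != ord_max.
  apply: contra npan => /eqP ck1; apply/forallP => b; apply/existsP.
  have [->|bm] := eqVneq b ord_max; first by exists k1; rewrite ck1.
  by have /implyP/(_ bm)/existsP[j /andP[_ cj]] := forallP d1 b; exists j.
have /implyP/(_ ck1)/existsP[k2 /andP[k21 /eqP ck2]] := forallP d1 (c k1).
apply: (@xor_pred2 _ _ k1 k2); first by rewrite eq_sym.
move=> k; apply/idP/orP => [dk|[/eqP->//|/eqP->]].
  have [inj _] := door_inj dk.
  have [->|kk1] := eqVneq k k1; [by left|right].
  apply: contraT => kk2; rewrite -(negbTE k21); apply/eqP.
  by apply: inj => //; rewrite !inE eq_sym.
apply/forallP => b; apply/implyP => bm.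
have /implyP/(_ bm)/existsP[j /andP[jk1 /eqP cj]] := forallP d1 b.
apply/existsP; have [jk2|jk2] := eqVneq j k2; last by exists j; rewrite jk2 cj /=.
by exists k1; rewrite eq_sym k21 -ck2 -jk2 cj /=.
Qed.

End one_simplex.

Section torus.
Variables n m : nat.
Let grid := {ffun 'I_n.+1 -> 'I_m}.

(** The simplices of the Kuhn triangulation of the torus are the pairs of a
    base vertex and a permutation telling at which step each coordinate is
    increased; [vertex s k] is reached after [k] steps.  Working on a torus
    leaves no boundary facet to be treated apart. *)
Definition vertex (s : grid * 'S_n.+1) (k : nat) : grid :=
  [ffun i => if (s.2 i < k)%N then ordS (s.1 i) else s.1 i].

(** The simplex on the other side of the facet opposite to the base vertex:
    the coordinate that was increased first is now increased last. *)
Definition next_simplex (s : grid * 'S_n.+1) : grid * 'S_n.+1 :=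
  (vertex s 1, (s.2 * perm (can_inj (@ord_predK n.+1)))%g).

Lemma next_simplex_inj : injective next_simplex.
Proof.
move=> [z p] [z' p'] [/ffunP zz' /mulIg pp']; rewrite -{}pp' in zz' *.
congr pair; apply/ffunP => i; have := zz' i; rewrite !ffunE /=.
by case: ifP => // _ /(can_inj (@ordSK m)).
Qed.

Lemma vertex_next s j : (j < n.+1)%N -> vertex (next_simplex s) j = vertex s j.+1.
Proof.
move=> jn; apply/ffunP => i; rewrite !ffunE /= permM permE /= !ltnS leqn0.
have := ltn_ord (s.2 i); case: (nat_of_ord (s.2 i)) => [|q] qn.
  by rewrite add0n modn_small //= ltnNge -ltnS jn.
by rewrite addSn -pred_Sn modnDr modn_small // ltnW.
Qed.

(** Swapping two consecutive steps replaces one inner vertex only: this is the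
    simplex on the other side of the facet opposite to that vertex. *)
Lemma vertex_tperm (s : grid * 'S_n.+1) (q : 'I_n.+1) (qn : (q.+1 < n.+1)%N) j :
  j != q.+1 -> vertex (s.1, (s.2 * tperm q (Ordinal qn))%g) j = vertex s j.
Proof.
move=> jq; apply/ffunP => i; rewrite !ffunE /= permM.
by case: tpermP => [->|->|//] /=; congr (if _ then _ else _); lia.
Qed.

Variable l : grid -> 'I_n.+2.

Let colors s (k : 'I_n.+2) := l (vertex s k).

Lemma xor_door0 : \big[addb/false]_s door (colors s) ord0
  = \big[addb/false]_s door (colors s) ord_max.
Proof.
rewrite [RHS](reindex_inj next_simplex_inj) /=; apply: eq_bigr => s _.
apply: eq_forallb => b; congr (_ ==> _).
apply/existsP/existsP => [] [j /andP[jk /eqP <-]].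
  have j0 : (0 < j)%N by rewrite lt0n.
  have jn : (j.-1 < n.+1)%N by have := ltn_ord j; lia.
  exists (inord j.-1); rewrite -val_eqE /= /colors inordK ?ltnS 1?ltnW//.
  by rewrite vertex_next // prednK // eqxx andbT neq_ltn jn.
have jn : (j < n.+1)%N by move: jk (ltn_ord j); rewrite -val_eqE /=; lia.
exists (inord j.+1); rewrite -val_eqE /= /colors inordK //.
by rewrite vertex_next // eqxx.
Qed.

(** Swapping the steps around [k] exchanges even and odd permutations and
    preserves the doors opposite to [k], which are therefore even in number. *)
Lemma xor_door_mid (k : 'I_n.+2) : (0 < k < n.+1)%N ->
  \big[addb/false]_s door (colors s) k = false.
Proof.
move=> k0n.
have qn : (k.-1.+1 < n.+1)%N by rewrite prednK; case/andP: k0n.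
pose q : 'I_n.+1 := Ordinal (ltnW qn).
pose t := tperm q (Ordinal (qn : q.+1 < n.+1)%N).
have qt : q != Ordinal (qn : q.+1 < n.+1)%N by rewrite -val_eqE /= neq_ltn ltnSn.
pose flip (s : grid * 'S_n.+1) := (s.1, (s.2 * t)%g).
have flip_inj : injective flip by move=> [z p] [z' p'] [-> /mulIg ->].
rewrite (bigID (fun s : grid * 'S_n.+1 => odd_perm s.2)) /=.
rewrite [X in _ (+) X](reindex_inj flip_inj) /=.
rewrite (eq_big (fun s : grid * 'S_n.+1 => odd_perm s.2)
  (fun s => door (colors (flip s)) k)).
- rewrite [X in _ (+) X](eq_bigl (fun s : grid * 'S_n.+1 => odd_perm s.2)).
    by rewrite addbb.
  move=> s.
  by rewrite odd_permM odd_tperm qt addbT negbK.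
- by [].
move=> s _; apply: eq_forallb => b; congr (_ ==> _).
apply: eq_existsb => j; case: eqVneq => //= jk.
by rewrite /colors vertex_tperm //= prednK //; case/andP: k0n.
Qed.

(** The panchromatic simplices are counted, modulo 2, by the doors of all the
    simplices, and each facet is shared by two simplices. *)
Lemma xor_panchromatic : \big[addb/false]_s panchromatic (colors s) = false.
Proof.
under eq_bigr do rewrite -xor_door.
rewrite exchange_big /= big_ord_recl big_ord_recr /=.
rewrite [X in _ (+) (X (+) _)]big1 => [|k _]; last first.
  by rewrite xor_door_mid // lift0 /= ltnS ltn_ord.
rewrite xor_door0 (_ : lift ord0 ord_max = ord_max); last exact: val_inj.
by rewrite addFb addbb.
Qed.

End torus.

(** * A Sperner lemma for cubical grids *)

Section Kuhn.
Variables n m : nat.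
Let grid := {ffun 'I_n.+1 -> 'I_m.+1}.

Section first_sign.
Variable P : 'I_n.+1 -> grid -> bool.

(** Kuhn's labelling: the index of the first condition that holds, or the last
    label when none does. *)
Definition first_sign (v : grid) : 'I_n.+2 :=
  inord (find (P^~ v) (enum 'I_n.+1)).

Lemma first_signP v i : (first_sign v = i :> nat) ->
  (forall j : 'I_n.+1, (j < i)%N -> ~~ P j v) /\
  (forall j : 'I_n.+1, j = i :> nat -> P j v).
Proof.
rewrite /first_sign inordK; last first.
  by rewrite ltnS (leq_trans (find_size _ _)) // size_enum_ord.
move=> fi; split=> j ji.
  have := @before_find _ ord0 (P^~ v) (enum 'I_n.+1) j.
  by rewrite fi nth_ord_enum => ->.
have := @nth_find _ ord0 (P^~ v) (enum 'I_n.+1).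
rewrite has_find fi size_enum_ord -ji ltn_ord nth_ord_enum; exact.
Qed.

Lemma first_signE v (i : nat) : (i <= n.+1)%N ->
  (forall j : 'I_n.+1, (j < i)%N -> ~~ P j v) ->
  (forall j : 'I_n.+1, j = i :> nat -> P j v) -> first_sign v = i :> nat.
Proof.
move=> le_in nP yP; have [lt ge] := first_signP (erefl (nat_of_ord (first_sign v))).
have := ltn_ord (first_sign v); rewrite ltnS => fn.
apply/eqP; rewrite eqn_leq; apply/andP; split; rewrite leqNgt; apply/negP => h.
  have il : (i < n.+1)%N by apply: leq_trans h fn.
  by have := lt (Ordinal il) h; rewrite yP.
have il : (first_sign v < n.+1)%N by apply: leq_trans h le_in.
by have := nP (Ordinal il) h; rewrite ge.
Qed.
End first_sign.

(** On the torus the coordinates wrap around from the last value to zero; the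
    simplices away from this seam are those of the cube. *)
Definition crosses_seam (s : grid * 'S_n.+1) := [exists i, s.1 i == ord_max].

Lemma ordS_lt (k : 'I_m.+1) : k != ord_max -> ordS k = k.+1 :> nat.
Proof.
move=> km; rewrite /= modn_small // ltnS.
by move: km (ltn_ord k); rewrite -val_eqE /=; lia.
Qed.

Lemma homo_perm_id (p : 'S_n.+1) :
  (forall i j : 'I_n.+1, (i < j)%N -> (p i < p j)%N) -> p = 1%g.
Proof.
move=> homo.
have ge (i : 'I_n.+1) : (i <= p i)%N.
  case: i => i; elim: i => [//|i IH] il.
  exact: leq_ltn_trans (IH (ltnW il)) (homo (Ordinal (ltnW il)) (Ordinal il) _).
have : (\sum_(i < n.+1) p i == \sum_(i < n.+1) i)%N.
  by rewrite [X in _ == X](reindex_inj (@perm_inj _ p)).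
rewrite eq_sym (leqif_sum (fun i _ => leqif_eq (ge i))).
move=> /forallP eq; apply/permP => i; rewrite perm1; apply/esym/val_inj/eqP.
exact: eq.
Qed.

(** Off the seam, for the labelling by the signs of the coordinates relative to
    [K], all the labels occur only on the simplex that leaves the corner [K] and
    increases the coordinates in their natural order. *)
Lemma linear_panchromatic (K : 'I_m.+1) (s : grid * 'S_n.+1) :
  (K < m)%N ->
  ~~ crosses_seam s && panchromatic (fun k : 'I_n.+2 =>
    first_sign (fun i (v : grid) => v i <= K)%N (vertex s k)) =
  (s == ([ffun=> K], 1%g)).
Proof.
move=> Km; apply/andP/eqP => [[/existsPn ns /forallP pan]|->]; last first.
  split.
    by apply/existsPn => i; rewrite ffunE -val_eqE /= neq_ltn Km.
  apply/forallP => b; apply/existsP; exists b; apply/eqP/val_inj/first_signE.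
  - by rewrite -ltnS ltn_ord.
  - by move=> j jb; rewrite !ffunE perm1 jb ordS_lt ?ltnn // -val_eqE /= neq_ltn Km.
  - by move=> j jb; rewrite !ffunE perm1 jb ltnn.
case: s => z p in ns pan *; rewrite /= in ns pan.
have hit (b : 'I_n.+2) : exists k : 'I_n.+2,
    (forall j : 'I_n.+1, (j < b)%N -> (K < z j + (p j < k))%N) /\
    (forall j : 'I_n.+1, j = b :> nat -> (z j + (p j < k) <= K)%N).
  have /existsP[k /eqP/(congr1 val)/first_signP[lt ge]] := pan b; exists k.
  have vE j : nat_of_ord (vertex (z, p) k j) = z j + (p j < k)%N.
    by rewrite ffunE /=; case: ifP => _; rewrite ?addn0 // ordS_lt // addn1.
  by split=> j jb; rewrite -vE ?ltnNge; [exact: lt|exact: ge].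
have zK j : z j = K :> nat.
  have [k [h _]] := hit ord_max; have := h j (ltn_ord j).
  have [k' [_ /(_ j (erefl _))]] := hit (widen_ord (leqnSn _) j).
  by move: (p j < k)%N (p j < k')%N => [] [] /=; lia.
have -> : z = [ffun=> K] by apply/ffunP => j; rewrite ffunE; exact/val_inj/zK.
congr pair; apply: homo_perm_id => i j ij.
have [k [/(_ i ij) + /(_ j (erefl _))]] := hit (widen_ord (leqnSn _) j).
by rewrite !zK; case: ltnP => // pik; case: ltnP => // pjk; lia.
Qed.

(** Conditions that agree on the boundary of the cube with those of the identity
    map give the same labels along the seam.  The linear labelling has exactly
    one panchromatic simplex off the seam, so an odd number of them across it;
    any labelling with the same seam then has an odd number of panchromatic
    simplices inside the cube. *)
Theorem kuhn_cube (K : 'I_m.+1) (P : 'I_n.+1 -> grid -> bool) : (K < m)%N ->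
  (forall v : grid, (exists i, v i = 0%N :> nat \/ v i = m :> nat) ->
    forall i, P i v = (v i <= K)%N) ->
  exists z : grid,
    (exists2 v : grid, (forall i, z i <= v i <= (z i).+1)%N & forall i, ~~ P i v) /\
    (forall i, exists2 v : grid, (forall i, z i <= v i <= (z i).+1)%N & P i v).
Proof.
move=> Km bdP.
pose Q i (v : grid) := (v i <= K)%N.
pose pan P s := panchromatic (fun k : 'I_n.+2 => first_sign P (vertex s k)).
have seam : \big[addb/false]_(s | crosses_seam s) pan P s = true.
  transitivity (\big[addb/false]_(s | crosses_seam s) pan Q s).
    apply: eq_bigr => s /existsP[i /eqP si].
    apply: eq_forallb => b; apply: eq_existsb => k; congr (_ == _).
    rewrite /first_sign; congr (inord _); apply: eq_find => j; apply: bdP.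
    exists i; rewrite ffunE si; case: ifP => _; [left|by right].
    by rewrite /= modnn.
  have := xor_panchromatic (first_sign Q); rewrite (bigID crosses_seam) /=.
  rewrite [X in _ (+) X]big_mkcond.
  rewrite [X in _ (+) X](eq_bigr (fun s => (s == ([ffun=> K], 1%g)))); last first.
    move=> s _; rewrite -linear_panchromatic //; by case: (crosses_seam s).
  rewrite [X in _ (+) X](@xor_pred1 _ _ ([ffun=> K], 1%g)) //.
  by case: (\big[_/_]_(_ | _) _).
have := xor_panchromatic (first_sign P); rewrite (bigID crosses_seam) /= seam.
have [s /andP[/existsPn ns /forallP panP] _|none] :=
  pickP (fun s => ~~ crosses_seam s && pan P s); last first.
  by rewrite big1 // => s ns; have := none s; rewrite ns.
have incell k i : (s.1 i <= vertex s k i <= (s.1 i).+1)%N.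
  by rewrite ffunE; case: ifP => _; rewrite ?leqnn ?leqnSn // ordS_lt // leqnSn leqnn.
exists s.1; split => [|i].
  have /existsP[k /eqP/(congr1 val)/first_signP[lt _]] := panP ord_max.
  by exists (vertex s k) => // i; apply: lt => /=.
have /existsP[k /eqP/(congr1 val)/first_signP[_ ge]] := panP (widen_ord (leqnSn _) i).
by exists (vertex s k) => //; apply: ge.
Qed.
End Kuhn.

(** * A zero of maps that are the identity far away *)

Local Open Scope classical_set_scope.
Local Open Scope ring_scope.

Section rV_norm.
Context {R : realType} {n : nat}.

Lemma rV_norm_leP (u : 'rV[R]_n) (c : R) : 0 <= c ->
  (forall i, `|u 0 i| <= c) -> `|u| <= c.
Proof.
move=> c0 uc; rewrite [leLHS]/Num.norm /= mx_normrE; apply/bigmax_leP.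
by split => //= -[i j] _ /=; rewrite (ord1 i).
Qed.

Lemma le_coord_rV_norm (u : 'rV[R]_n) i : `|u 0 i| <= `|u|.
Proof.
rewrite [leRHS]/Num.norm /= mx_normrE; apply/bigmax_geP; right => /=.
by exists (0, i).
Qed.

Lemma rV_linear_continuous (W : normedModType R) (f : {linear 'rV[R]_n -> W}) :
  continuous f.
Proof.
apply/linear_bounded_continuous/linear_boundedP.
near=> M => u; rewrite [u in f u]row_sum_delta linear_sum.
rewrite (le_trans (ler_norm_sum _ _ _)) //.
have -> : \sum_i `|f (u 0 i *: 'e_i)| = \sum_i `|u 0 i| * `|f 'e_i|.
  by apply: eq_bigr => i _; rewrite linearZ /= normrZ.
rewrite (@le_trans _ _ ((\sum_i `|f 'e_i|) * `|u|)) //.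
  rewrite mulr_suml ler_sum // => i _.
  by rewrite mulrC ler_wpM2l // le_coord_rV_norm.
by rewrite ler_wpM2r //; near: M; apply: nbhs_pinfty_ge; rewrite num_real.
Unshelve. all: by end_near. Qed.

End rV_norm.

Section kuhn_zero.
Context {R : realType} {n : nat}.

(** Without zeros, each point has a neighbourhood and a scale at which some
    coordinate of [H] keeps a strict sign, so that no cell of that scale close
    to that point sees both a point with all coordinates positive and, for each
    coordinate, a point where it is nonpositive.  By compactness one scale
    serves everywhere, and the grid of that scale contradicts [kuhn_cube]. *)
Theorem rV_zero (H : 'rV[R]_n.+1 -> 'rV[R]_n.+1) (r : R) : continuous H ->
  (forall u, r <= `|u| -> H u = u) -> exists u, H u = 0.
Proof.
move=> Hcont Hr; apply: contrapT => /forallNP noz.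
pose r' := Num.max r 1; have r'0 : 0 < r' by rewrite lt_max ltr01 orbT.
have rr' : r <= r' by rewrite le_max lexx.
pose B : set 'rV[R]_n.+1 := [set u | `|u| <= 2 * r'].
have Bcpt : compact B.
  apply: bounded_closed_compact.
    exists (2 * r'); split; first exact: num_real.
    by move=> x lx u /le_trans; apply; exact: ltW.
  rewrite (_ : B = closed_ball_ Num.Def.normr 0 (2 * r')); first exact: closed_closed_ball_.
  by apply/seteqP; split => u; rewrite /B /closed_ball_ /= sub0r normrN.
pose bad (e : R) (x : 'rV[R]_n.+1) :=
  ~ ((exists2 v, `|x - v| <= e & forall i, 0 < H v 0 i) /\
     (forall i, exists2 w, `|x - w| <= e & H w 0 i <= 0)).
have : \forall e \near 0^'+, B `<=` bad e.
  apply: (proj1 (compact_near_coveringP B) Bcpt) => x _.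
  have [i Hx0] : exists i, H x 0 i != 0.
    apply: contrapT => /forallNP h; apply: (noz x); apply/rowP => i; rewrite mxE.
    by apply/eqP/negPn/negP; exact: h.
  have Hi : continuous (fun u => H u 0 i).
    move=> u; apply: (@continuous_comp _ _ _ H (fun M => M 0 i)).
      exact: Hcont.
    exact: coord_continuous.
  have := Hi x; move=> /cvgrPdist_lt /(_ `|H x 0 i|); rewrite normr_gt0 => /(_ Hx0).
  move=> /nbhs_ballP[d /= d0 Hd].
  near=> x' e => /=.
  have x'd : `|x - x'| < d / 2.
    near: x'; apply/nbhs_ballP; exists (d / 2); rewrite /= ?divr_gt0 // => y.
    by rewrite -ball_normE.
  have ed : e < d / 2 by near: e; apply: nbhs_right_lt; rewrite divr_gt0.
  have key v : `|x' - v| <= e -> `|H x 0 i - H v 0 i| < `|H x 0 i|.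
    move=> vx; apply: Hd; rewrite -ball_normE /=.
    rewrite (_ : x - v = (x - x') + (x' - v)); last by rewrite addrA subrK.
    rewrite (le_lt_trans (ler_normD _ _)) // [d]splitr ltrD //.
    exact: le_lt_trans ed.
  move=> [[v /key vx /(_ i) v0] /(_ i) [w /key wx w0]].
  move: vx wx; have [h|h|h] := ltgtP (H x 0 i) 0; last by move: Hx0; rewrite h eqxx.
    by move=> + _; rewrite (ltr0_norm h) ltr_norml => /andP[]; lra.
  by move=> _; rewrite (gtr0_norm h) ltr_norml => /andP[]; lra.
move=> Bbad.
have [e [e0 er' {}Bbad]] : exists e, [/\ 0 < e, e < r' & B `<=` bad e].
  near (0 : R)^'+ => e; exists e; split; near: e => //.
  - exact: nbhs_right_gt.
  - exact: nbhs_right_lt.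
(* half of the side of the grid, in steps of length e: the grid covers the
   ball of radius r', outside which H is the identity *)
pose K := (Num.truncn (r' / e)).+1.
have Kge : r' <= e * K%:R.
  by rewrite mulrC -ler_pdivrMr // ltW // /K truncnS_gt.
have Kle : e * K%:R <= 2 * r'.
  have : (Num.truncn (r' / e))%:R <= r' / e by rewrite truncn_le divr_ge0 // ltW.
  by rewrite ler_pdivlMr // /K -natr1; lra.
have Km : (K < (K.*2).+1)%N by rewrite ltnS -addnn leq_addr.
pose pt (v : {ffun 'I_n.+1 -> 'I_(K.*2).+1}) : 'rV[R]_n.+1 :=
  \row_i (e * ((v i)%:R - K%:R)).
pose P i v := H (pt v) 0 i <= 0.
have [||z [[v vz vP] wP]] := @kuhn_cube n K.*2 (Ordinal Km) P.
- by rewrite /= -addnn -addSnnS leq_addr.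
- move=> v [j vj] i; rewrite /P Hr.
    by rewrite mxE pmulr_rle0 // subr_le0 ler_nat.
  rewrite (le_trans rr') // (le_trans Kge) //.
  rewrite (le_trans _ (le_coord_rV_norm _ j)) // mxE normrM (gtr0_norm e0) ler_pM2l //.
  case: vj => ->; first by rewrite sub0r normrN normr_nat.
  by rewrite -addnn natrD addrK normr_nat.
have dist (u : {ffun 'I_n.+1 -> 'I_(K.*2).+1}) :
    (forall i, z i <= u i <= (z i).+1)%N -> `|pt z - pt u| <= e.
  move=> uz; apply: rV_norm_leP; first exact: ltW.
  move=> i; rewrite !mxE -mulrBr normrM (gtr0_norm e0) -[leRHS]mulr1 ler_pM2l //.
  rewrite opprB addrA subrK; have /andP[zu] := uz i.
  rewrite -(ler_nat R) -natr1 => uz1; move: zu; rewrite -(ler_nat R) => zu.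
  by rewrite ler_norml; lra.
apply: (Bbad (pt z)).
  apply: rV_norm_leP; first by rewrite mulr_ge0 // ltW.
  move=> i; rewrite mxE normrM (gtr0_norm e0) (le_trans _ Kle) // ler_pM2l //.
  have := ltn_ord (z i); rewrite ltnS -(ler_nat R).
  rewrite (_ : K.*2%:R = K%:R + K%:R); last by rewrite -addnn natrD.
  move=> zK.
  have : (0 : R) <= (z i)%:R by [].
  by rewrite ler_norml; lra.
split; first by exists (pt v); [exact: dist|move=> i; rewrite ltNge; exact: vP].
by move=> i; have [w wz wi] := wP i; exists (pt w); [exact: dist|].
Unshelve. all: by end_near. Qed.

End kuhn_zero.

(** * Compactness in finite-dimensional normed spaces *)

Section finite_dimensional.
Context {R : realType} {V : normedVectType R}.

Lemma r2v_continuous : continuous (@r2v R V).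
Proof. exact: rV_linear_continuous. Qed.

Lemma norm_r2v_continuous : continuous (fun u => `|@r2v R V u|).
Proof. by move=> u; apply: (cvg_norm (@r2v_continuous u)). Qed.

(** The equivalence of the norms: the norm of V attains a positive minimum on
    the compact unit sphere of the space of coordinates. *)
Lemma v2r_bounded : exists2 C : R, 0 < C & forall x : V, `|v2r x| <= C * `|x|.
Proof.
have [n0|n0] := posnP (dim V).
  exists 1 => // x; rewrite (_ : v2r x = 0) ?normr0 ?mulr_ge0 //.
  by apply/rowP => i; have := ltn_ord i; rewrite [X in (_ < X)%N]n0.
pose S : set 'rV[R]_(dim V) := [set u | `|u| = 1].
have S0 : S !=set0.
  exists (const_mx 1); rewrite /S /=; apply/eqP; rewrite eq_le; apply/andP; split.
    by apply: rV_norm_leP => // i; rewrite mxE normr1.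
  by rewrite (le_trans _ (le_coord_rV_norm _ (Ordinal n0))) // mxE normr1.
have Scpt : compact S.
  apply: bounded_closed_compact.
    exists 1; split; first exact: num_real.
    by move=> x lx u; rewrite /S /= => ->; exact: ltW.
  rewrite (_ : S = Num.Def.normr @^-1` [set 1]); last by [].
  by apply: closed_comp => [u _|]; [exact: norm_continuous|exact: closed_eq].
have cont : {within S, continuous (fun u => `|@r2v R V u|)}.
  apply: continuous_subspaceT => u.
  exact: norm_r2v_continuous.
have [c /set_mem /= Sc minc] := compact_EVT_min S0 Scpt cont.
have c0 : 0 < `|@r2v R V c|.
  rewrite normr_gt0; apply/eqP => /(congr1 v2r); rewrite r2vK linear0 => c0.
  by move: Sc; rewrite /S /= c0 normr0 => /eqP; rewrite eq_sym oner_eq0.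
exists `|@r2v R V c|^-1 => [|x]; first by rewrite invr_gt0.
have [->|x0] := eqVneq x 0; first by rewrite linear0 !normr0 mulr0.
have vx0 : 0 < `|v2r x| by rewrite normr_gt0 -(linear0 v2r) (inj_eq (@v2r_inj R V)).
rewrite mulrC ler_pdivlMr // mulrC -ler_pdivlMr //.
rewrite (le_trans (minc (`|v2r x|^-1 *: v2r x) _)) //.
  by rewrite inE /S /= normrZ normfV normr_id mulVf // gt_eqF.
by rewrite -linearZ v2rK normrZ normfV normr_id mulrC.
Qed.

Lemma v2r_continuous : continuous (@v2r R V).
Proof.
have [C C0 hC] := v2r_bounded.
apply/linear_bounded_continuous/linear_boundedP.
near=> M => x; rewrite (le_trans (hC x)) // ler_wpM2r //.
Unshelve. all: by end_near. Qed.

Lemma compact_norm_le (r : R) : compact [set x : V | `|x| <= r].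
Proof.
have [C C0 hC] := v2r_bounded.
pose B := [set u | `|@r2v R V u| <= r].
rewrite (_ : [set x | _] = r2v @` B).
  apply: continuous_compact; first exact/continuous_subspaceT/r2v_continuous.
  apply: bounded_closed_compact.
    exists (C * r); split; [exact: num_real|move=> x lx u ur].
    apply: le_trans (ltW lx); rewrite -[u]r2vK (le_trans (hC _)) //.
    by rewrite ler_pM2l.
  rewrite (_ : B = (fun u => `|@r2v R V u|) @^-1` [set x | x <= r]) //.
  apply: closed_comp => [u _|]; last exact: closed_le.
  exact: norm_r2v_continuous.
apply/seteqP; split => [x xr|_ [u ur <-]] //.
by exists (v2r x); rewrite /B /= v2rK.
Qed.

Theorem zero_of_identity_at_infinity (G : V -> V) (r : R) :
  continuous G -> (forall x, r <= `|x| -> G x = x) -> exists x, G x = 0.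
Proof.
move=> Gcont Gr; have [C C0 hC] := v2r_bounded.
pose H u := v2r (G (r2v u)).
have Hcont : continuous H.
  move=> u; apply: (@continuous_comp _ _ _ (G \o r2v) v2r); last exact: v2r_continuous.
  by apply: continuous_comp; [exact: r2v_continuous|exact: Gcont].
have Hid u : C * r <= `|u| -> H u = u.
  move=> ru; rewrite /H Gr ?r2vK // -(ler_pM2l C0) (le_trans ru) //.
  by rewrite -[u in `|u|]r2vK.
suff [u Hu] : exists u, H u = 0.
  by exists (r2v u); apply: v2r_inj; rewrite linear0.
clearbody H; move: (dim V) H Hcont Hid => [|n] H Hcont Hid.
  by exists 0; apply/rowP => -[].
exact: rV_zero Hcont Hid.
Qed.

End finite_dimensional.

(** * Asymptotics of near-isometries *)

Lemma ultra_fmap (S T : Type) (F : set_system S) (f : S -> T) :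
  UltraFilter F -> UltraFilter (f @ F).
Proof.
move=> FU; split; first exact: fmap_proper_filter.
move=> G GF FG; apply/seteqP; split=> [A GA|A /FG//].
have [//|FnA] := in_ultra_setVsetC (f @^-1` A) FU.
have GnA : G (~` A) by apply: FG.
exfalso; apply: (@filter_not_empty _ G); rewrite -(setICr A).
exact: filterI.
Qed.

Lemma nbhs_dist_lt (R : realType) (V : normedModType R) (x : V) (e : R) :
  0 < e -> \forall y \near x, `|x - y| < e.
Proof.
by move=> e0; apply/nbhs_ballP; exists e => //= y; rewrite -ball_normE.
Qed.

Section isometry.
Context {R : realType} {V : normedVectType R}.

Lemma isometry_continuous (U : V -> V) :
  (forall x y, `|U x - U y| = `|x - y|) -> continuous U.
Proof.
move=> iso x; apply/cvgrPdist_lt => e e0; near=> y; rewrite iso.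
by near: y; exact: nbhs_dist_lt.
Unshelve. all: by end_near. Qed.

(** If [p] were missed, it would be at a positive distance from the image of the
    compact ball of radius the norm of [p]; the iterates of [U] at [p], which
    stay in that ball, would be pairwise at least that far apart. *)
Lemma isometry_surj (U : V -> V) :
  (forall x y, `|U x - U y| = `|x - y|) -> U 0 = 0 -> forall p, exists x, U x = p.
Proof.
move=> iso U0 p; apply: contrapT => /forallNP nU.
pose K : set V := [set x | `|x| <= `|p|].
have UK x : K x -> K (U x).
  by rewrite /K /= -[in `|U x|](subr0 (U x)) -[X in U x - X]U0 iso subr0.
have Kcpt : compact K := @compact_norm_le R V `|p|.
have gap_continuous : continuous (fun x => `|p - U x|).
  move=> x; apply: (@cvg_norm _ _ _ (nbhs x)).
  by apply: cvgB; [exact: cvg_cst|exact: isometry_continuous].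
have [||c /set_mem Kc minc] := @compact_EVT_min _ _ (fun x => `|p - U x|) K _ Kcpt.
- by exists 0; rewrite /K /= normr0.
- exact: (continuous_subspaceT gap_continuous).
have c0 : 0 < `|p - U c| by rewrite normr_gt0 subr_eq0 eq_sym; exact/eqP/nU.
have Kiter k : K (iter k U p) by elim: k => [|k IH]; [exact: lexx|exact: UK].
have sep k l : (k < l)%N -> `|p - U c| <= `|iter k U p - iter l U p|.
  elim: k l => [|k IH] [//|l] kl; last by rewrite /= iso IH.
  by apply: minc; apply/mem_set/Kiter.
have [q [_ /= clq]] := Kcpt ((fun k => iter k U p) @ \oo) _
  (filterS (fun k _ => Kiter k) filterT).
have near_q m : exists2 k, (m <= k)%N & `|q - iter k U p| < `|p - U c| / 2.
  have [_ [[k mk <-] qk]] := clq [set iter k U p | k in [set k | (m <= k)%N]]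
    (ball q (`|p - U c| / 2))
    (filterS (fun k mk => ex_intro2 _ _ k mk erefl) (nbhs_infty_ge m))
    (nbhsx_ballx q _ (divr_gt0 c0 (ltr0Sn R 1))).
  by exists k => //; move: qk; rewrite -ball_normE.
have [k _ qk] := near_q 0%N; have [l kl ql] := near_q k.+1.
have := sep _ _ kl; rewrite leNgt => /negP; apply.
rewrite [ltRHS]splitr (le_lt_trans (ler_distD q _ _)) // ltrD //.
by rewrite distrC.
Qed.

End isometry.

Section near_isometry.
Context {R : realType} {V : normedVectType R}.
Variables (f : V -> V) (d : R).
Hypothesis near_iso : forall x y, `| `|f x - f y| - `|x - y| | <= d.

Let g (n : nat) (x : V) : V := n.+1%:R^-1 *: f (n.+1%:R *: x).

Let gB n x y : g n x - g n y = n.+1%:R^-1 *: (f (n.+1%:R *: x) - f (n.+1%:R *: y)).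
Proof. by rewrite scalerBr. Qed.

Let g_near_iso n x y : `| `|g n x - g n y| - `|x - y| | <= d / n.+1%:R.
Proof.
have n0 : (0 : R) < n.+1%:R by [].
rewrite ler_pdivlMr // -[X in _ * X](gtr0_norm n0) -normrM mulrBl gB normrZ.
rewrite normfV (gtr0_norm n0) mulrAC mulVf ?gt_eqF // mul1r.
by rewrite mulrC -[X in X * `|x - y|](gtr0_norm n0) -normrZ scalerBr.
Qed.

Let d_ge0 : 0 <= d. Proof. exact: le_trans (near_iso 0 0). Qed.

Let dist_g n x y : `|g n x - g n y| <= `|x - y| + d.
Proof.
have := g_near_iso n x y; rewrite ler_norml => /andP[_].
have : d / n.+1%:R <= d by rewrite ler_pdivrMr // ler_peMr // ler1n.
by set c := d / _; lra.
Qed.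

Let small (F : set_system nat) (c : R) : \oo `<=` F -> ProperFilter F ->
  c / n.+1%:R @[n --> F] --> 0.
Proof.
move=> ooF FF; have : c / n.+1%:R @[n --> \oo] --> 0.
  by rewrite -[X in _ --> X](mulr0 c); apply: cvgMr; exact: cvg_harmonic.
by move=> cv A /cv; exact: ooF.
Qed.

(** The rescaled maps change distances by at most [d / n.+1] and stay bounded at
    each point, so that they converge along an ultrafilter to an isometry; the
    ultrafilter replaces the extraction of a subsequence working for all points
    at once. *)
Lemma near_isometry_tangent : exists F : set_system nat, exists U : V -> V,
  [/\ ProperFilter F, \oo `<=` F, (forall x y, `|U x - U y| = `|x - y|), U 0 = 0 &
    forall x, g n x @[n --> F] --> U x].
Proof.
have [F [FU ooF]] := ultraFilterLemma eventually_filter.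
have FP : ProperFilter F by exact: ultra_proper.
have : forall x : V, exists p : V, g n x @[n --> F] --> p.
  move=> x; pose K : set V := [set y | `|y| <= `|x| + d + `|f 0|].
  have Kcpt : compact K by exact: compact_norm_le.
  have gK n : K (g n x).
    rewrite /K /= -(subrK (g n 0) (g n x)) (le_trans (ler_normD _ _)) // lerD //.
      by have := dist_g n x 0; rewrite subr0.
    rewrite /g scaler0 normrZ normfV normr_nat ler_piMl // invf_le1 // ler1n //.
  move: Kcpt; rewrite compact_ultra => /(_ _ (ultra_fmap (g^~ x) FU)).
  by case=> [|p [_ cp]]; [apply: (@filterE _ F) => n; exact: gK|exists p].
move=> /(@choice V V)[U gU]; exists F, U; split => //.
  move=> x y.
  have : `|g n x - g n y| @[n --> F] --> `|U x - U y|.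
    by apply: cvg_norm; exact: cvgB.
  have : `|g n x - g n y| @[n --> F] --> `|x - y|.
    apply/cvgrPdist_lt => e e0.
    have /cvgrPdist_lt/(_ e e0) := small d ooF FP.
    apply: filterS => n; rewrite sub0r normrN distrC.
    apply: le_lt_trans; apply: (le_trans (g_near_iso n x y)); exact: ler_norm.
  by move=> h1 h2; apply: cvg_unique h2 h1.
apply: cvg_unique (gU 0) _ => //.
apply/cvgrPdist_lt => e e0.
have /cvgrPdist_lt/(_ e e0) := small `|f 0| ooF FP.
apply: filterS => n; rewrite !sub0r !normrN /g scaler0 normrM => lte.
by rewrite normrZ mulrC -[X in X * _]normr_id.
Qed.

(** [W] is the inverse of the tangent isometry [U], transported to the ball of
    radius [N].  Being near-isometries, the rescaled maps converge to [U]
    uniformly on the unit ball. *)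
Theorem near_isometry_rescaled (e M : R) : 0 < e ->
  exists N : R, exists W : V -> V,
    [/\ M <= N, 0 < N, (forall y y', `|W y - W y'| = `|y - y'|), W 0 = 0 &
      forall x, `|x| <= N -> `|W (f x) - x| <= e * N].
Proof.
move=> e0; have [F [U [FF ooF isoU U0 gU]]] := near_isometry_tangent.
have /(@choice V V)[T UT] := isometry_surj isoU U0.
have isoT y y' : `|T y - T y'| = `|y - y'| by rewrite -isoU !UT.
have TU x : T (U x) = x.
  by apply/eqP; rewrite -subr_eq0 -normr_eq0 -isoU UT subrr normr0.
have unif : \forall n \near F,
    [set x | `|x| <= 1] `<=` (fun x => `|g n x - U x| <= e).
  apply: (proj1 (compact_near_coveringP _) (@compact_norm_le R V 1)) => x _.
  have e4 : 0 < e / 4 by rewrite divr_gt0.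
  near=> x' n => /=.
  have xx' : `|x - x'| < e / 4.
    by near: x'; exact: nbhs_dist_lt.
  have gx : `|U x - g n x| < e / 4.
    by near: n; exact: (cvgr_dist_lt _ _ (gU x) _ e4).
  have dn : d / n.+1%:R < e / 4.
    near: n; have /cvgrPdist_lt/(_ _ e4) := small d ooF FF.
    apply: filterS => k; rewrite sub0r normrN.
    by apply: le_lt_trans; exact: ler_norm.
  have gg : `|g n x' - g n x| <= e / 4 + e / 4.
    have := g_near_iso n x' x; rewrite ler_norml (distrC x' x) => /andP[_].
    by move: dn; set c := d / _; lra.
  have UU : `|U x - U x'| < e / 4 by rewrite isoU.
  rewrite (le_trans (ler_distD (g n x) _ _)) //.
  have := ler_distD (U x) (g n x) (U x'); rewrite (distrC (g n x) (U x)); lra.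
have [n [Mn nunif]] : exists n,
    M <= n.+1%:R /\ [set x | `|x| <= 1] `<=` (fun x => `|g n x - U x| <= e).
  have MF : \forall n \near F, M <= n.+1%:R.
    apply: ooF; near=> n; rewrite ltW // (lt_le_trans (truncnS_gt M)) // ler_nat ltnS.
    by near: n; exact: nbhs_infty_ge.
  by have [n] := filter_ex (filterI MF unif); exists n.
have n0 : (0 : R) < n.+1%:R by [].
exists n.+1%:R, (fun y => n.+1%:R *: T (n.+1%:R^-1 *: y)); split => //.
- move=> y y'; rewrite -scalerBr normrZ isoT -scalerBr -normrZ scalerA.
  by rewrite mulfV ?gt_eqF // scale1r.
- by rewrite scaler0 -[X in T X]U0 TU scaler0.
move=> x xn; pose x' := n.+1%:R^-1 *: x.
have xE : x = n.+1%:R *: x' by rewrite scalerA mulfV ?gt_eqF // scale1r.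
rewrite {2}xE -scalerBr normrZ gtr0_norm // mulrC ler_pM2r //.
rewrite -[X in _ - X]TU isoT {1}xE; apply: nunif.
by rewrite /= normrZ normfV gtr0_norm // mulrC ler_pdivrMr // mul1r.
Unshelve. all: by end_near. Qed.

End near_isometry.

(** * Averaging over superlevel sets *)

Section level_sets.
Context {R : realType} {T : topologicalType} {I : finType}.
Variable phi : I -> T -> R.

(** For nonnegative [phi], a continuous substitute for the barycentric
    coordinates of a point in the barycentric subdivision: a nonempty [s] has
    positive weight at [x] exactly when it is a superlevel set of [phi ^~ x]
    with a nonnegative threshold. *)
Definition level_weight (s : {set I}) (x : T) : R :=
  \prod_(i in s) (phi i x *
    \prod_(j | j \notin s) Num.max 0 (phi i x - phi j x)).

Definition level_mean (V : normedModType R) (y : {set I} -> V) (x : T) : V :=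
  (\sum_(s : {set I} | s != finset.set0) level_weight s x)^-1 *:
  \sum_(s : {set I} | s != finset.set0) level_weight s x *: y s.

Section continuity.
Hypothesis phi_continuous : forall i, continuous (phi i).

Lemma level_weight_continuous s : continuous (level_weight s).
Proof.
have mulc := @mul_continuous R.
apply: continuous_big => // i _ x; apply: cvgM; first exact: phi_continuous.
move: x; apply: continuous_big => // j _ x.
apply: (@continuous_max _ _ (cst 0) (fun x => phi i x - phi j x)).
  exact: cvg_cst.
by apply: cvgB; exact: phi_continuous.
Qed.

Lemma level_mean_continuous (V : normedModType R) (y : {set I} -> V) x :
  \sum_(s : {set I} | s != finset.set0) level_weight s x != 0 ->
  {for x, continuous (level_mean y)}.
Proof.
move=> S0; apply: cvgZ.
  apply: cvgV => //; move: x {S0}; apply: continuous_big => [|s _].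
    exact: add_continuous.
  exact: level_weight_continuous.
move: x {S0}; apply: continuous_big => [|s _ x]; first exact: add_continuous.
by apply: cvgZr_tmp; exact: level_weight_continuous.
Qed.

End continuity.

Section pointwise.
Variable x : T.
Hypothesis phi_ge0 : forall i, 0 <= phi i x.

Lemma level_weight_ge0 s : 0 <= level_weight s x.
Proof.
apply: prodr_ge0 => i _; rewrite mulr_ge0 //; apply: prodr_ge0 => j _.
by rewrite le_max lexx.
Qed.

Lemma level_weight_support s (i j : I) : level_weight s x != 0 ->
  i \in s -> phi i x != 0 /\ (phi i x <= phi j x -> j \in s).
Proof.
move=> w0 si.
have : phi i x * \prod_(j | j \notin s) Num.max 0 (phi i x - phi j x) != 0.
  by apply: contraNneq w0 => h; apply/prodf_eq0; exists i => //; rewrite h.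
rewrite mulf_eq0 negb_or => /andP[-> p0]; split => // le_ij.
apply: contraNT p0 => sj; apply/prodf_eq0; exists j => //.
by rewrite max_l // subr_le0.
Qed.

Lemma level_weight_sum_gt0 (i : I) : 0 < phi i x ->
  0 < \sum_(s : {set I} | s != finset.set0) level_weight s x.
Proof.
move=> phi_i; pose i0 := [arg max_(k > i) phi k x]%O.
have maxP k : phi k x <= phi i0 x by rewrite /i0; case: arg_maxP => // m _; exact.
pose s0 := finset (fun k => phi k x == phi i0 x).
have s0i0 : i0 \in s0 by rewrite inE.
rewrite (bigD1 s0) /=; last by apply/set0Pn; exists i0.
rewrite ltr_wpDr //; first by apply: sumr_ge0 => s _; exact: level_weight_ge0.
apply: prodr_gt0 => k; rewrite inE => /eqP ->.
rewrite mulr_gt0 ?(lt_le_trans phi_i (maxP i)) //; apply: prodr_gt0 => j.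
by rewrite inE => jm; rewrite lt_max ltxx subr_gt0 lt_neqAle jm maxP.
Qed.

(** All the superlevel sets contain an index [i0] that maximizes [phi ^~ x], so
    that the [y s] of positive weight all lie in the ball of radius [r] around
    [c i0]. *)
Lemma level_mean_close (V : normedModType R) (y : {set I} -> V) (c : I -> V)
    (r : R) (i : I) : 0 < phi i x ->
  (forall (s : {set I}) k, (forall j, j \in s -> 0 < phi j x) -> k \in s ->
    `|y s - c k| <= r) ->
  exists2 k, 0 < phi k x & `|level_mean y x - c k| <= r.
Proof.
move=> phi_i yr; pose i0 := [arg max_(k > i) phi k x]%O.
have maxP k : phi k x <= phi i0 x by rewrite /i0; case: arg_maxP => // m _; exact.
exists i0; first exact: lt_le_trans (maxP i).
have S0 := level_weight_sum_gt0 phi_i; rewrite /level_mean.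
set S := \sum_(_ | _) _ in S0 *.
have -> : c i0 = S^-1 *:
    \sum_(s : {set I} | s != finset.set0) level_weight s x *: c i0.
  by rewrite -scaler_suml scalerA mulVf ?scale1r // gt_eqF.
rewrite -scalerBr -sumrB normrZ normfV gtr0_norm // ler_pdivrMl //.
rewrite (le_trans (ler_norm_sum _ _ _)) // /S mulr_suml ler_sum // => s s0.
rewrite -scalerBr normrZ ger0_norm ?level_weight_ge0 //.
have [->|w0] := eqVneq (level_weight s x) 0; first by rewrite !mul0r.
rewrite ler_wpM2l ?level_weight_ge0 //; apply: yr.
  move=> j sj; have [p0 _] := level_weight_support j w0 sj.
  by rewrite lt_neqAle eq_sym p0 phi_ge0.
have /set0Pn[j sj] := s0.
by have [_] := level_weight_support i0 w0 sj; apply; exact: maxP.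
Qed.

End pointwise.
End level_sets.

(** The net is fine enough, with mesh [e / 2], for the points whose tents are
    positive at a common point to be pairwise at distance less than [e]. *)
Theorem continuous_approximation (R : realType) (V : normedModType R)
    (f : V -> V) (K : set V) (e r : R) : compact K -> 0 < e ->
  (forall A : set V, (forall a b, A a -> A b -> `|a - b| < e) ->
    exists y, forall a, A a -> `|y - f a| <= r) ->
  exists F : V -> V, forall x, K x -> {for x, continuous F} /\
    exists2 v, `|x - v| < e & `|F x - f v| <= r.
Proof.
move=> Kcpt e0 center; have e20 : 0 < e / 2 by rewrite divr_gt0.
have [D _ DK] : finite_subset_cover K (fun v : V => ball v (e / 2)) K.
  move: Kcpt; rewrite compact_cover; apply => [v _|x Kx].
    exact: ball_open.
  by exists x => //; exact: ballxx.
pose phi (i : D) (x : V) : R := Num.max 0 (e / 2 - `|x - val i|).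
have phi_cont i : continuous (phi i).
  move=> x; apply: (@continuous_max _ _ (cst 0) (fun x => e / 2 - `|x - val i|)).
    exact: cvg_cst.
  apply: cvgB; first exact: cvg_cst.
  by apply: cvg_norm; apply: cvgB; [exact: cvg_id|exact: cvg_cst].
have phi_ge0 i x : 0 <= phi i x by rewrite le_max lexx.
have phi_gt0 i x : (0 < phi i x) = (`|x - val i| < e / 2).
  by rewrite lt_max ltxx subr_gt0.
have /choice[y yP] : forall s : {set D}, exists y : V,
    (forall i j, i \in s -> j \in s -> `|val i - val j| < e) ->
    forall i, i \in s -> `|y - f (val i)| <= r.
  move=> s; have [h|h] := pselect
    (forall i j, i \in s -> j \in s -> `|val i - val j| < e); last by exists 0.
  have [|y yP] := center [set v | exists2 i : D, i \in s & val i = v].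
    by move=> _ _ [i si <-] [j sj <-]; exact: h.
  by exists y => _ i si; apply: yP; exists i.
exists (level_mean phi y) => x Kx.
have [i phi_i] : exists i, 0 < phi i x.
  have [v Dv] := DK x Kx; rewrite -ball_normE /= => vx.
  by exists (FSetSub Dv); rewrite phi_gt0 distrC.
split.
  apply: level_mean_continuous => //.
  by rewrite gt_eqF // (@level_weight_sum_gt0 _ _ _ phi x (phi_ge0^~ x) i).
have [|k phi_k Fk] := @level_mean_close _ _ _ phi x (phi_ge0^~ x) V y
  (fun i => f (val i)) r i phi_i.
  move=> s k ps sk; apply: yP => // j l /ps + /ps; rewrite !phi_gt0 => xj xl.
  rewrite (le_lt_trans (ler_distD x _ _)) // distrC [ltRHS]splitr.
  exact: ltrD.
exists (val k) => //; move: phi_k; rewrite phi_gt0 => /lt_trans; apply.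
by rewrite gtr_pMr // invf_lt1 // ltr1n.
Qed.

(** * Surjectivity of maps close to near-isometries *)

Section near_identity.
Context {R : realType} {V : normedVectType R}.

(** A cutoff interpolates between [G] and the identity, which creates no new
    zero: the displacement is at most [r], and [G] is left unchanged on the
    ball of radius [r]. *)
Theorem zero_near_identity (G : V -> V) (r : R) : 0 < r ->
  (forall x, `|x| <= 2 * r -> {for x, continuous G} /\ `|G x - x| <= r) ->
  exists2 x, `|x| <= r & G x = 0.
Proof.
move=> r0 Gr.
(* equal to 1 up to radius r and to 0 from radius 3 r / 2 on: the margin up to
   2 r makes the glued map continuous *)
pose chi (x : V) : R := Num.max 0 (Num.min 1 (3 - 2 * `|x| / r)).
have chi_cont : continuous chi.
  move=> x.
  apply: (@continuous_max _ _ (cst 0) (fun x => Num.min 1 (3 - 2 * `|x| / r))).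
    exact: cvg_cst.
  apply: (@continuous_min _ _ (cst 1) (fun x => 3 - 2 * `|x| / r)).
    exact: cvg_cst.
  apply: cvgB; first exact: cvg_cst.
  apply: cvgM; last exact: cvg_cst.
  by apply: cvgM; [exact: cvg_cst|exact: norm_continuous].
have chi_small x : `|x| <= r -> chi x = 1.
  move=> xr; have : `|x| / r <= 1 by rewrite ler_pdivrMr // mul1r.
  rewrite /chi -mulrA; move: (_ / _) => t t1; rewrite min_l ?max_r //; lra.
have chi_large x : 3 / 2 * r <= `|x| -> chi x = 0.
  rewrite -ler_pdivlMr // => xr; rewrite /chi -mulrA; move: (_ / r) xr => t t1.
  by rewrite max_l // ge_min; apply/orP; right; lra.
have chi_le1 x : 0 <= chi x <= 1.
  by rewrite le_max lexx ge_max ler01 ge_min lexx.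
pose H x := x + chi x *: (G x - x).
have Hid x : 3 / 2 * r <= `|x| -> H x = x.
  by move=> xr; rewrite /H chi_large // scale0r addr0.
have Hcont : continuous H.
  move=> x; have [xr|xr] := ltP `|x| (2 * r).
    apply: cvgD; first exact: cvg_id.
    apply: cvgZ; first exact: chi_cont.
    by apply: cvgB; [exact: (Gr x (ltW xr)).1|exact: cvg_id].
  rewrite /continuous_at Hid; last by apply: le_trans xr; lra.
  apply/cvgrPdist_lt => e e0; near=> y.
  have yr : 3 / 2 * r <= `|y|.
    have : `|x - y| < r / 2.
      by near: y; apply: nbhs_dist_lt; rewrite divr_gt0.
    have := ler_distD y x 0; rewrite !subr0; lra.
  rewrite Hid //; near: y; exact: nbhs_dist_lt.
have [x Hx] := zero_of_identity_at_infinity Hcont Hid.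
have [xr|xr] := leP (3 / 2 * r) `|x|.
  by move: (xr); rewrite -(Hid x xr) Hx normr0; lra.
have [_ Gxr] : {for x, continuous G} /\ `|G x - x| <= r by apply: Gr; lra.
have xr' : `|x| <= r.
  have -> : x = - (chi x *: (G x - x)).
    by apply/eqP; rewrite -addr_eq0; apply/eqP.
  have /andP[c0 c1] := chi_le1 x.
  by rewrite normrN normrZ ger0_norm // (le_trans _ Gxr) // ler_piMl.
exists x => //; have := Hx; rewrite /H chi_small // scale1r addrC subrK; exact.
Unshelve. all: by end_near. Qed.

(** The continuous approximation [F] of [f] is followed by the isometry [W] that
    straightens [f]; a zero of [W \o F - W p] is a point sent to [p] by [F], as
    [W] is injective. *)
Theorem near_isometry_approx_surj (f : V -> V) (d e r : R) : 0 < e ->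
  (forall x y, `| `|f x - f y| - `|x - y| | <= d) ->
  (forall A : set V, (forall a b, A a -> A b -> `|a - b| < e) ->
    exists y, forall a, A a -> `|y - f a| <= r) ->
  forall p, exists v, `|p - f v| <= r.
Proof.
move=> e0 near_iso center p.
have r0 : 0 <= r.
  have [|y /(_ 0 erefl)] := center [set 0]; last exact: le_trans.
  by move=> _ _ -> ->; rewrite subrr normr0.
(* N bounds 8 times all the errors that do not grow with N, so that the total
   displacement is at most N / 8 + N / 8 on the ball of radius N / 2; the net
   points v seen from that ball lie in the ball of radius N *)
have [N [W [MN N0 isoW W0 WN]]] :=
  near_isometry_rescaled near_iso (8 * (r + e + `|p|))
    (divr_gt0 ltr01 (ltr0Sn R 7)).
have [F FK] := @continuous_approximation R V f [set x | `|x| <= N / 2] e r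
  (@compact_norm_le R V _) e0 center.
have WFclose x : `|x| <= N / 2 -> `|W (F x) - W p - x| <= N / 4.
  move=> xN; have [_ [v xv Fv]] := FK x xN.
  have vN : `|v| <= N.
    have := ler_distD x v 0; rewrite !subr0 (distrC v x).
    have := normr_ge0 p; lra.
  have WF : `|W (F x) - W (f v)| <= r by rewrite isoW.
  have Wp : `|W p| = `|p| by rewrite -[W p]subr0 -W0 isoW subr0.
  have -> : W (F x) - W p - x =
      (W (F x) - W (f v)) + (W (f v) - v) + (v - x) - W p.
    by rewrite !subrKA addrAC.
  have h1 := ler_normB ((W (F x) - W (f v)) + (W (f v) - v) + (v - x)) (W p).
  have h2 := ler_normD ((W (F x) - W (f v)) + (W (f v) - v)) (v - x).
  have h3 := ler_normD (W (F x) - W (f v)) (W (f v) - v).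
  have h4 := WN v vN; have h5 : `|v - x| < e by rewrite distrC.
  lra.
have [|x xN|x xN /eqP] := @zero_near_identity (fun x => W (F x) - W p) (N / 4).
- by rewrite divr_gt0.
- have xN2 : `|x| <= N / 2 by lra.
  split; last exact: WFclose.
  apply: cvgB; last exact: cvg_cst.
  apply: (@continuous_comp _ _ _ F W); first exact: (FK x xN2).1.
  exact: isometry_continuous.
rewrite -normr_eq0 isoW normr_eq0 subr_eq0 => /eqP Fx.
have xN2 : `|x| <= N / 2 by lra.
by have [_ [v _ Fv]] := FK x xN2; exists v; rewrite -Fx.
Qed.

End near_identity.

(** * The relative Jung constant *)

Section jung.
Context {R : realType} {V : normedModType R}.
Local Notation J := (relative_jung_constant V).
Local Open Scope ereal_scope.

(** Any point of [X] is a centre of radius at most the diameter. *)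
Lemma relative_jung_constant_le1 : J <= 1.
Proof.
apply: ge_ereal_sup => _ [X X1 <-].
have [x0 Xx0] : X !=set0.
  apply: contrapT => X0; have : diameter X <= 0.
    by apply: ge_ereal_sup => ? [x Xx _]; case: X0; exists x.
  by rewrite X1 leNgt lte01.
apply: (@le_trans _ _ (ereal_sup [set (mdist x (x0 : metric_normed V))%:E | x in X])).
  apply: ereal_inf_lbound; exists x0 => //.
  exact: (@sub_gen_smallest _ _ X).
rewrite -X1; apply: ge_ereal_sup => _ [x Xx <-].
by apply: ereal_sup_ubound; exists x => //; exists x0.
Qed.

(** Two points at distance 1 have no centre of radius less than 1/2. *)
Lemma relative_jung_constant_gt0 : (exists u : V, u != 0%R) -> 0 < J.
Proof.
move=> [u u0]; pose v : V := (`|u|^-1 *: u)%R.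
have v1 : `|v|%R = 1%R by rewrite normrZ normfV normr_id mulVf // normr_eq0.
pose X : set (metric_normed V) := [set (0%R : V); v].
have X1 : diameter X = 1.
  apply/eqP; rewrite eq_le; apply/andP; split.
    apply: ge_ereal_sup => _ [x [->|->] [y [->|->] <-]]; rewrite lee_fin /mdist /=.
    - by rewrite subrr normr0.
    - by rewrite sub0r normrN v1.
    - by rewrite subr0 v1.
    - by rewrite subrr normr0.
  apply: ereal_sup_ubound; exists v; first by right.
  by exists (0%R : V); [left|rewrite /mdist /= subr0 v1].
apply: (@lt_le_trans _ _ (2^-1)%:E); first by rewrite lte_fin invr_gt0.
apply: (le_trans _ (ereal_sup_ubound (ex_intro2 _ _ X X1 erefl))).
apply: le_ereal_inf_tmp => _ [y _ <-].
have h0 : (`|0 - (y : V)|)%:E <= ereal_sup [set (mdist x y)%:E | x in X].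
  by apply: ereal_sup_ubound; exists (0%R : V) => //; left.
have hv : (`|v - (y : V)|)%:E <= ereal_sup [set (mdist x y)%:E | x in X].
  by apply: ereal_sup_ubound; exists v => //; right.
have [h|h] := leP 2^-1%R `|0 - (y : V)|%R.
  by apply: le_trans h0; rewrite lee_fin.
apply: le_trans hv; rewrite lee_fin.
have := ler_normD (v - (y : V))%R (y : V); rewrite subrK v1.
by move: h; rewrite sub0r normrN; lra.
Qed.

(** The relative Jung constant bounds radii at diameter 1: rescale [A] by its
    diameter, unless it is reduced to one point. *)
Lemma exists_chebyshev_center (A : set V) (j c : R) : (0 <= j)%R -> J < j%:E ->
  (forall a b, A a -> A b -> (`|a - b| <= c)%R) ->
  exists y, forall a, A a -> (`|y - a| <= j * c)%R.
Proof.
move=> j0 Jj Ac; have [[a0 Aa0]|nA] := pselect (A !=set0); last first.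
  by exists 0%R => a Aa; case: nA; exists a.
pose D : set R := [set `|a - b|%R | a in A & b in A].
have D0 : D !=set0 by exists `|a0 - a0|%R, a0 => //; exists a0.
have Dc : ubound D c by move=> _ [a Aa [b Ab <-]]; exact: Ac.
have supD : has_sup D by split => //; exists c.
pose d := sup D.
have Dd a b : A a -> A b -> (`|a - b| <= d)%R.
  by move=> Aa Ab; apply: sup_upper_bound => //; exists a => //; exists b.
have dc : (d <= c)%R by apply: ge_sup.
have d0 : (0 <= d)%R := le_trans (normr_ge0 _) (Dd _ _ Aa0 Aa0).
have [d_eq0|d_gt0] : d = 0%R \/ (0 < d)%R.
  by move: d0; rewrite le_eqVlt eq_sym => /orP[/eqP|]; [left|right].
  exists a0 => a Aa; have := Dd _ _ Aa0 Aa; rewrite d_eq0 => /le_trans; apply.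
  by rewrite mulr_ge0 // (le_trans _ dc).
pose X : set (metric_normed V) := [set (d^-1 *: a)%R | a in A].
have distX a b : (`|d^-1 *: a - d^-1 *: b| = `|a - b| / d)%R.
  by rewrite -scalerBr normrZ normfV gtr0_norm // mulrC.
have X1 : diameter X = 1.
  apply/eqP; rewrite eq_le; apply/andP; split.
    apply: ge_ereal_sup => _ [_ [a Aa <-] [_ [b Ab <-] <-]]; rewrite lee_fin.
    by rewrite /mdist /= distX ler_pdivrMr // mul1r Dd.
  rewrite leNgt; apply/negP => ltX1.
  have leX a b : A a -> A b -> (`|a - b| / d)%:E <= diameter X.
    move=> Aa Ab; apply: ereal_sup_ubound; exists (d^-1 *: a)%R; first by exists a.
    by exists (d^-1 *: b)%R; [exists b|rewrite /mdist /= distX].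
  have := leX _ _ Aa0 Aa0; rewrite subrr normr0 mul0r => le0X.
  have diamE : diameter X = (fine (diameter X))%:E.
    by rewrite fineK // ge0_fin_numE // (lt_trans ltX1) // ltry.
  move: ltX1 leX le0X; rewrite diamE; set t := fine _; rewrite !lte_fin => t1 leX t0.
  have : (d <= t * d)%R.
    apply: ge_sup => // _ [a Aa [b Ab <-]].
    by rewrite -ler_pdivrMr // -lee_fin leX.
  by apply/negP; rewrite -ltNge gtr_pMl.
have : relative_chebyshev_radius (convex_hull X : set (metric_normed V)) X < j%:E.
  by apply: le_lt_trans Jj; apply: ereal_sup_ubound; exists X.
move=> /ereal_inf_lt [_ [y _ <-]] ltj.
exists (d *: (y : V))%R => a Aa.
have : (mdist (d^-1 *: a : metric_normed V) y)%:E <= j%:E.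
  apply: le_trans (ltW ltj); apply: ereal_sup_ubound.
  by exists (d^-1 *: a)%R => //; exists a.
rewrite lee_fin /mdist /= => le_j.
rewrite (_ : d *: (y : V) - a = - (d *: (d^-1 *: a - (y : V))))%R; last first.
  by rewrite scalerBr scalerA mulfV ?gt_eqF // scale1r opprB.
rewrite normrN normrZ gtr0_norm // mulrC ler_pM //; exact: normr_ge0.
Qed.

End jung.

(** * Comparison of the two distances *)

Section gromov_hausdorff.
Context {R : realType} {V : normedVectType R}.

Lemma near_isometry_of_hausdorff_dist (X : set (metric_normed V))
    (Z : metricType R) (A B : set Z) (r : R) :
  isometric [set: metric_normed V] A -> isometric X B ->
  (hausdorff_dist A B < r%:E)%E ->
  exists2 f : V -> V, (forall v, X (f v)) &
    forall x y, `| `|f x - f y| - `|x - y| | <= 2 * r.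
Proof.
move=> [phi [iso_phi <-]] [psi [iso_psi <-]] ltr.
have /choice[f fP] : forall v : V, exists w : V,
    X w /\ mdist (phi v) (psi w) < r.
  move=> v; have : (dist_to_set (phi v) (psi @` X) < r%:E)%E.
    apply: le_lt_trans ltr; rewrite /hausdorff_dist le_max; apply/orP; left.
    by apply: ereal_sup_ubound; exists (phi v) => //; exists v.
  by move=> /ereal_inf_lt [_ [_ [w Xw <-] <-]]; rewrite lte_fin => ?; exists w.
exists f => [v|x y]; first by have [] := fP v.
have [Xx xr] := fP x; have [Xy yr] := fP y.
have e1 : mdist (psi (f x)) (psi (f y)) = `|f x - f y| by rewrite iso_psi.
have e2 : mdist (phi x) (phi y) = `|x - y| by rewrite iso_phi.
rewrite -e1 -e2.
have t1 := metric_triangle (psi (f x)) (phi x) (psi (f y)).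
have t2 := metric_triangle (phi x) (phi y) (psi (f y)).
have t3 := metric_triangle (phi x) (psi (f x)) (phi y).
have t4 := metric_triangle (psi (f x)) (psi (f y)) (phi y).
rewrite (metric_sym (psi (f x)) (phi x)) in t1.
rewrite (metric_sym (psi (f y)) (phi y)) in t4.
by rewrite ler_norml; apply/andP; split; lra.
Qed.

(** Sets of diameter less than [t] have images of diameter less than [d + t],
    hence with centres of radius [j (d + t)] for any [j > J]; [j] and [t] are
    chosen below so that this is at most [J d + e]. *)
Lemma hausdorff_dist_le_near_isometry (X : set (metric_normed V)) (f : V -> V)
    (d J : R) : (forall v, X (f v)) ->
  (forall x y, `| `|f x - f y| - `|x - y| | <= d) ->
  0 <= J -> (relative_jung_constant V <= J%:E)%E ->
  (hausdorff_dist [set: metric_normed V] X <= (J * d)%:E)%E.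
Proof.
move=> Xf near_iso J0 leJ.
have d0 : 0 <= d by rewrite (le_trans _ (near_iso 0 0)).
rewrite /hausdorff_dist ge_max; apply/andP; split; last first.
  apply: ge_ereal_sup => _ [x Xx <-].
  apply: (@le_trans _ _ 0%E); last by rewrite lee_fin mulr_ge0.
  by apply: ereal_inf_lbound; exists x; rewrite // mdistxx.
apply: ge_ereal_sup => _ [p _ <-]; apply/lee_addgt0Pr => e e0.
have d1 : 0 < d + 1 by rewrite ltr_wpDl.
pose j := J + e / 2 / (d + 1).
have Jj : J < j by rewrite ltrDl !divr_gt0.
have j0 : 0 < j := le_lt_trans J0 Jj.
have ej0 : 0 < e / 2 / j by rewrite !divr_gt0.
have [|v pv] :=
    near_isometry_approx_surj ej0 near_iso (r := j * (d + e / 2 / j)) _ p.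
  move=> A Ae.
  have [||y yP] := @exists_chebyshev_center R V (f @` A) j (d + e / 2 / j) (ltW j0).
  - exact: le_lt_trans leJ _.
  - move=> _ _ [a Aa <-] [b Ab <-]; have := near_iso a b; rewrite ler_norml => /andP[_].
    by have := Ae _ _ Aa Ab; set t := e / 2 / j; lra.
  by exists y => a Aa; apply: yP; exists a.
apply: (@le_trans _ _ (mdist (p : metric_normed V) (f v))%:E).
  by apply: ereal_inf_lbound; exists (f v).
rewrite -EFinD lee_fin (le_trans pv) // mulrDr [j * (e / 2 / j)]mulrC divfK ?gt_eqF //.
rewrite [e in leRHS]splitr addrA lerD2r /j mulrDl lerD2l.
by rewrite mulrAC ler_pdivrMr // ler_pM2l ?divr_gt0 // lerDl.
Qed.

End gromov_hausdorff.

Local Open Scope ereal_scope.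

Theorem theorem3p1 (R : realType) (V : normedVectType R)
    (dimV : (1 <= \dim {:V})%N) (X : set (metric_normed V)) (X0 : X !=set0) :
  gromov_hausdorff_dist [set: metric_normed V] X >=
    (2%:E * relative_jung_constant V)^-1 * hausdorff_dist [set: metric_normed V] X.
Proof.
have J_gt0 : 0 < relative_jung_constant V.
  apply: relative_jung_constant_gt0; exists (vpick {:V}).
  by rewrite vpick0 -dimv_eq0 -lt0n.
have J_le1 := @relative_jung_constant_le1 R V.
have JE : relative_jung_constant V = (fine (relative_jung_constant V))%:E.
  by rewrite fineK // ge0_fin_numE ?(le_lt_trans J_le1) ?ltry // ltW.
move: (J_gt0); rewrite JE; set J := fine _ => J0; rewrite lte_fin in J0.
have J20 : (0 < 2 * J)%R by rewrite mulr_gt0.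
rewrite -EFinM inver gt_eqF //.
apply: le_ereal_inf_tmp => _ [Z [A [B [isoA isoB ->]]]]; rewrite lee_pdivrMl //.
have bound s : hausdorff_dist A B < s%:E ->
    (0 <= s)%R /\ hausdorff_dist [set: metric_normed V] X <= (J * (2 * s))%:E.
  move=> lts.
  have [f Xf near_iso] := near_isometry_of_hausdorff_dist isoA isoB lts.
  split; first by rewrite -(pmulr_rge0 _ (ltr0Sn R 1)) (le_trans _ (near_iso 0 0)%R).
  by apply: hausdorff_dist_le_near_isometry Xf near_iso _ _; [exact: ltW|rewrite JE].
case dE: (hausdorff_dist A B) bound => [r||] bound.
- (* the excess e / (2 J) over r costs e after multiplication by 2 J *)
  apply/lee_addgt0Pr => e e0.
  have [|_ le_rs] := bound (r + e / (2 * J))%R.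
    by rewrite lte_fin ltrDl divr_gt0.
  apply: le_trans le_rs _; rewrite -EFinM -EFinD lee_fin mulrA (mulrC J) mulrDr.
  by rewrite [X in (_ + X)%R]mulrC divfK ?gt_eqF.
- by rewrite mulry gtr0_sg // mul1e leey.
- by have [|] := bound (- 1)%R; [rewrite ltNyr|rewrite oppr_ge0 ler10].
Qed.
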